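(* Assume a Turing instability occurs at $\mu=0$, and consider the stripes on $\Omega_{\rm qh}=[0,4\pi/\kappa]\times[0,4\pi/(\sqrt3\ell)]$, $\kappa=k_c+\tilde\kappa$, $\ell=k_c+\tilde\ell$, $\tilde\ell\ne\tilde\kappa$, rescaled to $\Omega_3=[0,4\pi]\times[0,4\pi/\sqrt3]$, with periodic boundary conditions, scaling $(A,\alpha,\beta,\tilde\kappa,\tilde\ell)=(\varepsilon A',\varepsilon^2\alpha',\varepsilon\beta',\varepsilon\kappa',\varepsilon\ell')$, and velocity parameter $c=c(\mu)=-\lambda_\beta+\mathcal{O}(\varepsilon)$ of the stripes. Let $\theta\in(0,1]$ be defined by $\omega=-\theta\rho_\kappa\tilde\kappa^2$, where $\omega=(9\tilde\ell+15\tilde\kappa)(\tilde\ell-\tilde\kappa)\rho_\kappa/16$. Then the quasi-hexagonal stability boundary, i.e., zero real part of the eigenvalues of the matrix $L_2^{\rm qh}$ (the subblock of the linearisation in stripes defined in the context), is to leading order given as follows. (i) If $Q=g(\varepsilon)Q'$ with $g(\varepsilon)=o(\varepsilon)$, this stability boundary reads $$\alpha=\mathcal{M}_{\rm qh}(\tilde\kappa,\beta;\theta):=-\frac74\rho_\beta\beta^2-(\theta+1)\rho_\kappa\tilde\kappa^2.$$ (ii) If $Q=\varepsilon Q'$ (with $Q'$ bounded in $\varepsilon$), this stability boundary is given by the two curves $$\{\alpha=\mathcal{M}_{\rm qH}^\pm(\tilde\kappa,\beta,q;\theta):\ \alpha\ge\mathcal{M}_{\rm qh}(\tilde\kappa,\beta;\theta),\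 \delta_{\mathcal M}\ge0\},$$ $$\{\alpha=\mathcal{M}_{\rm qH}^\pm(\tilde\kappa,\beta,q;\theta):\ \alpha\le\mathcal{M}_{\rm qh}(\tilde\kappa,\beta;\theta),\ \delta_{\mathcal M}\ge0\},$$ corresponding to the two eigenvalues $\lambda_\sigma$ of $L_2^{\rm qh}$ with possibly different $\sigma=\pm$, where \begin{align*} \mathcal{M}_{\rm qH}^\pm(\tilde\kappa,\beta,q;\theta)&:=-\frac74\rho_\beta\beta^2-(\theta+1)\rho_\kappa\tilde\kappa^2-\frac1{3k_0}\left(2q^2\pm\sqrt{\delta_{\mathcal M}}\right),\\ \delta_{\mathcal M}&:=4q^4+9k_0\rho_\beta\beta^2q^2+12k_0\theta\rho_\kappa\tilde\kappa^2q^2. \end{align*}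
   Context: System: $u_t=D\Delta u+Lu+\check\alpha Mu+\beta Bu_x+Q[u,u]+K[u,u,u]$, $u\in\mathbb{R}^2$, $\mathbf{x}=(x,y)\in\mathbb{R}^2$; $D=\mathrm{diag}(d_1,d_2)$, $d_i>0$; $L=\begin{pmatrix}a_1&a_2\\ a_3&a_4\end{pmatrix}$ and $M$ real $2\times2$ matrices; $Q$, $K$ symmetric bilinear/trilinear on $\mathbb{R}^2$, extended multilinearly to $\mathbb{C}^2$; $B=B(c)=\mathrm{diag}(1+c,c)$ with $c\in\mathbb{R}$. Turing instability with wavenumber $k_c>0$ at $\check\alpha=\beta=0$: with $\hat{\mathcal L}(k,\ell)=-(k^2+\ell^2)D+L+\check\alpha M+\mathrm{i}k\beta B$ and $d(\lambda,k,\ell)=\det(\hat{\mathcal L}(k,\ell)-\lambda\,\mathrm{Id})$, at $\check\alpha=\beta=0$: (1) all eigenvalues of $L$ have negative real part; (2) $d=0$ and $\mathrm{Re}\,\lambda\ge0$ iff $\lambda=0$ and $k^2+\ell^2=k_c^2$; (3) $\partial_\lambda d\ne0$ there. Set $\lambda_M:=-\partial_{\check\alpha}d/\partial_\lambda d$ (at $\check\alpha=0,\lambda=0$), assumed nonzero, and $\alpha:=\lambda_M\check\alpha$. Coefficients: $E_0,E_0^*\in\mathbb{R}^2$ span the kernels of $-k_c^2D+L$ and its transpose, $\langle E_0,E_0\rangle=\langle E_0,E_0^*\rangle=1$. $(-k_c^2D+L)^{-1}$ denotes the inverse from the range to the kernel of the projection $\langle\cdot,E_0^*\rangle E_0$.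 All coefficients are evaluated at $\mu=0$, where $c=-\lambda_\beta$, $\lambda_\beta=\frac{a_4-k_c^2d_2}{a_1+a_4-k_c^2(d_1+d_2)}$, so $\langle BE_0,E_0^*\rangle=0$. Define $Q_0=-2L^{-1}Q[\overline{E_0},E_0]$, $Q_2=-2(-4k_c^2D+L)^{-1}Q[E_0,E_0]$, $q_0=\langle Q[E_0,Q_0],E_0^*\rangle$, $q_2=\langle Q[\overline{E_0},Q_2],E_0^*\rangle$, $k_0=\langle K[E_0,E_0,\overline{E_0}],E_0^*\rangle$, $\rho_{\rm nl}=3k_0+2q_0+q_2$, $w_{A\beta}=k_c(-k_c^2D+L)^{-1}(\langle BE_0,E_0^*\rangle-B)E_0$, $w_{A\kappa}=2k_c(-k_c^2D+L)^{-1}DE_0$, $\rho_\beta=-k_c\langle Bw_{A\beta},E_0^*\rangle>0$, $\rho_\kappa=-2k_c\langle Dw_{A\kappa},E_0^*\rangle<0$. Standing assumption: $\rho_{\rm nl}<0$ (so, for small $Q$ as in the claim, also $k_0<0$). Scaling: as in the claim, with $0<\varepsilon\ll1$ and primed quantities bounded; $\mu=(\alpha,\beta,\tilde\kappa)=\varepsilon\mu_1+\varepsilon^2\mu_2$, so $\mu_1$ carries $(\beta',\kappa')$. The boundaries in the claim are written in unscaled parameters ($\alpha=\varepsilon^2\alpha'$ etc.); ''to leading order'' means at leading order in $\varepsilon$. Stripes (known existence result): nontrivial small travelling waves constant in $y$, $2\pi/\kappa$-periodic in $x$, velocity $\beta c$ with $c=c(\mu)=-\lambda_\beta+\mathcal{O}(\varepsilon)$,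 leading-order profile $2\varepsilon A'E_0\cos(\kappa x)$ up to translation, in 1-to-1 correspondence with solutions $A=\varepsilon A'>0$ of $\varepsilon^2(\alpha'+\rho_\beta\beta'^2+\rho_\kappa\kappa'^2+\rho_{\rm nl}A'^2+\mathcal{O}(\varepsilon))=0$. The matrix $L_2^{\rm qh}$: on $\Omega_3$ there is a six-dimensional centre manifold with coordinates $u_c=\sum_{j=\pm1,\pm2,\pm3}u_j\mathrm{e}^{\mathrm{i}\mathbf{k}_j\cdot\mathbf{x}}E_0$, $\mathbf{k}_1=(1,0)$, $\mathbf{k}_2=(-1/2,\sqrt3/2)$, $\mathbf{k}_3=-(1/2,\sqrt3/2)$, $\mathbf{k}_{-j}=-\mathbf{k}_j$. The linearisation of the reduced ODE in stripes in index ordering $(1,-1,2,-3,3,-2)$ is $\mathrm{diag}(L_1,L_2^{\rm qh},L_2^{\rm qh})+\mathcal{O}(\varepsilon^3)$ with $$L_2^{\rm qh}=\varepsilon^2\begin{pmatrix}\lambda'_{\mu,\tilde\ell}+A'^2\eta&2A'\frac{q}{\varepsilon}+A'p(\mu_1,\ell')\\2A'\frac{q}{\varepsilon}+A'\overline{p(\mu_1,\ell')}&\lambda'_{\mu,\tilde\ell}+A'^2\eta\end{pmatrix},$$ $\lambda'_{\mu,\tilde\ell}=\alpha'+\frac14\rho_\beta\beta'^2+\frac{\rho_\kappa}{16}(\kappa'+3\ell')^2+\mathcal{O}(\varepsilon)$ (real), $q=\langle Q[E_0,E_0],E_0^*\rangle$, $\eta=6k_0+2q_0+8q_1$, $q_1=\langle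 Q[E_0,Q_1],E_0^*\rangle$, $Q_1=(-k_c^2D+L)^{-1}(\langle Q[E_0,E_0],E_0^*\rangle E_0-Q[E_0,E_0])$, $p(\mu_1,\ell')=\langle Q[\mathrm{i}\beta'w_{A\beta}+(\frac52\kappa'+\frac32\ell')w_{A\kappa},E_0]-(\mathrm{i}\beta'k_cB+(\kappa'+3\ell')k_cD)Q_1,E_0^*\rangle$. Its two eigenvalues are denoted $\lambda_\pm$ (sign of the contribution of the modulus of the off-diagonal entry). *)

(* Defs.v *)
From HB Require Import structures.
From mathcomp Require Import all_boot all_order all_algebra.
From mathcomp Require Import all_classical all_reals all_analysis.
From mathcomp Require Import complex.

Set Implicit Arguments.
Unset Strict Implicit.
Unset Printing Implicit Defensive.

Import Order.TTheory GRing.Theory Num.Theory.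
Import numFieldNormedType.Exports.

Local Open Scope classical_set_scope.
Local Open Scope ring_scope.
Local Open Scope complex_scope.

(* Vectors, bilinear and trilinear maps over an arbitrary commutative ring.
   A bilinear map on T^2 is given by its coefficients, output index first, so
   that its multilinear extension from R to C is the coefficientwise image. *)

Definition tensor2 (T : Type) := 'I_2 -> 'I_2 -> 'I_2 -> T.
Definition tensor3 (T : Type) := 'I_2 -> 'I_2 -> 'I_2 -> 'I_2 -> T.

Definition symmetric2 (T : Type) (q : tensor2 T) : Prop :=
  forall i j k, q i j k = q i k j.

Definition symmetric3 (T : Type) (t : tensor3 T) : Prop :=
  forall i j k l, t i j k l = t i k j l /\ t i j k l = t i j l k.

Definition bil (T : comNzRingType) (q : tensor2 T) (u v : 'cV[T]_2) : 'cV[T]_2 :=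
  \col_i \sum_j \sum_k q i j k * u j 0 * v k 0.

Definition tri (T : comNzRingType) (t : tensor3 T) (u v w : 'cV[T]_2) : 'cV[T]_2 :=
  \col_i \sum_j \sum_k \sum_l t i j k l * u j 0 * v k 0 * w l 0.

(* No conjugation: the second argument is always a real vector. *)
Definition dot (T : comNzRingType) (u v : 'cV[T]_2) : T :=
  \sum_i u i 0 * v i 0.

Definition advection (T : comNzRingType) (c : T) : 'M[T]_2 :=
  diag_mx (\row_(i < 2) if i == 0 then 1 + c else c).

Record model (R : realType) := Model {
  d1 : R; d2 : R;
  Lm : 'M[R]_2;
  Mm : 'M[R]_2;
  Kt : tensor3 R;
  kc : R;
  E0 : 'cV[R]_2;
  E0s : 'cV[R]_2 }.

Section Model.
Variables (R : realType) (S : model R).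

Definition Dm : 'M[R]_2 := diag_mx (\row_(i < 2) if i == 0 then d1 S else d2 S).

(* det(-(k^2 + l^2) D + L + al M + i k be B(c) - lam Id).  The parameters live
   in a ring T containing the reals through f and the imaginary unit im: T is
   R[i] for values and {poly R[i]} for partial derivatives. *)
Definition dispersion (T : comNzRingType) (f : R -> T) (im : T)
    (c al be k l lam : T) : T :=
  \det (- (k ^+ 2 + l ^+ 2) *: map_mx f Dm + map_mx f (Lm S)
        + al *: map_mx f (Mm S) + (im * k * be) *: advection c - lam%:M).

Definition dispC (c al be k l : R) (lam : R[i]) : R[i] :=
  dispersion (real_complex R) 'i%C c%:C al%:C be%:C k%:C l%:C lam.

Definition dispP (al k l lam : {poly R[i]}) : {poly R[i]} :=
  dispersion (fun x : R => polyC x%:C) (polyC 'i%C) 0 al 0 k l lam.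

(* Both partial derivatives are taken at al = be = 0 and lam = 0, where c plays
   no role. *)
Definition dlam_disp (k l : R) : R[i] :=
  (deriv (dispP 0 (k%:C)%:P (l%:C)%:P 'X)).[0].

Definition dal_disp (k l : R) : R[i] :=
  (deriv (dispP 'X (k%:C)%:P (l%:C)%:P 0)).[0].

Definition lambda_M : R := complex.Re (- (dal_disp (kc S) 0) / dlam_disp (kc S) 0).

Definition Nc : 'M[R]_2 := - (kc S) ^+ 2 *: Dm + Lm S.

(* At al = be = 0 the value of c is immaterial. *)
Definition turing_instability : Prop :=
  [/\ 0 < d1 S, 0 < d2 S & 0 < kc S] /\
  [/\ forall z : R[i], eigenvalue (map_mx (real_complex R) (Lm S)) z ->
        complex.Re z < 0,
      forall (z : R[i]) (k l : R),
        (dispC 0 0 0 k l z = 0 /\ 0 <= complex.Re z) <->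
        (z = 0 /\ k ^+ 2 + l ^+ 2 = kc S ^+ 2)
    & forall k l : R, k ^+ 2 + l ^+ 2 = kc S ^+ 2 -> dlam_disp k l != 0].

Definition critical_vectors : Prop :=
  [/\ forall v : 'cV[R]_2, Nc *m v = 0 <-> exists a : R, v = a *: E0 S,
      forall v : 'cV[R]_2, Nc^T *m v = 0 <-> exists a : R, v = a *: E0s S,
      dot (E0 S) (E0 S) = 1
    & dot (E0 S) (E0s S) = 1].

(* For v in the range of Nc this is the unique preimage in the kernel of
   <., E0s> E0; it is only ever applied to such v. *)
Definition Nc_inv (v : 'cV[R]_2) : 'cV[R]_2 :=
  xget 0 [set w | Nc *m w = v /\ dot w (E0s S) = 0].

Definition lambda_be : R :=
  (Lm S 1 1 - kc S ^+ 2 * d2 S) /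
  (Lm S 0 0 + Lm S 1 1 - kc S ^+ 2 * (d1 S + d2 S)).

(* At c = - lambda_be one has <B(c) E0, E0s> = 0. *)
Definition B0 : 'M[R]_2 := advection (- lambda_be).

Definition w_be : 'cV[R]_2 :=
  kc S *: Nc_inv ((dot (B0 *m E0 S) (E0s S))%:M *m E0 S - B0 *m E0 S).

Definition w_ka : 'cV[R]_2 := (2 * kc S) *: Nc_inv (Dm *m E0 S).

Definition rho_be : R := - kc S * dot (B0 *m w_be) (E0s S).

Definition rho_ka : R := - 2 * kc S * dot (Dm *m w_ka) (E0s S).

Definition k0 : R := dot (tri (Kt S) (E0 S) (E0 S) (E0 S)) (E0s S).

(* E0 is real, so the conjugates of E0 in the coefficients are E0 itself. *)
Section Quadratic.
Variable Q : tensor2 R.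

Definition Q0 : 'cV[R]_2 := - 2 *: (invmx (Lm S) *m bil Q (E0 S) (E0 S)).

Definition Q2 : 'cV[R]_2 :=
  - 2 *: (invmx (- (4 * kc S ^+ 2) *: Dm + Lm S) *m bil Q (E0 S) (E0 S)).

Definition qcoef : R := dot (bil Q (E0 S) (E0 S)) (E0s S).

Definition Q1 : 'cV[R]_2 := Nc_inv (qcoef *: E0 S - bil Q (E0 S) (E0 S)).

Definition q0 : R := dot (bil Q (E0 S) Q0) (E0s S).
Definition q1 : R := dot (bil Q (E0 S) Q1) (E0s S).
Definition q2 : R := dot (bil Q (E0 S) Q2) (E0s S).

Definition rho_nl : R := 3 * k0 + 2 * q0 + q2.
Definition eta : R := 6 * k0 + 2 * q0 + 8 * q1.

Definition pcoef (be ka el : R) : R[i] :=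
  let toC m (A : 'M[R]_(2, m)) := map_mx (real_complex R) A in
  dot (bil (fun i j k => (Q i j k)%:C)
         (('i%C * be%:C) *: toC _ w_be
          + (5 / 2 * ka + 3 / 2 * el)%:C *: toC _ w_ka)
         (toC _ (E0 S))
       - (('i%C * be%:C * (kc S)%:C) *: toC _ B0
          + ((ka + 3 * el) * kc S)%:C *: toC _ Dm) *m toC _ Q1)
      (toC _ (E0s S)).

(* The block of the linearisation of the reduced vector field, with index
   pairs (2,-3) and (3,-2).  al, be, ka, el and A are the scaled (primed) quantities; r is the O(e)
   remainder of lambda'. *)
Definition lambda_prime (al be ka el r : R) : R :=
  al + rho_be * be ^+ 2 / 4 + rho_ka / 16 * (ka + 3 * el) ^+ 2 + r.

Definition L2qh_mx (e al be ka el A r : R) : 'M[R[i]]_2 :=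
  let diag := (lambda_prime al be ka el r + A ^+ 2 * eta)%:C in
  let lead := (2 * A * (qcoef / e))%:C in
  (e ^+ 2)%:C *:
    \matrix_(i, j)
      if i == j then diag
      else if i == 0 then lead + A%:C * pcoef be ka el
      else lead + A%:C * conjc (pcoef be ka el).

(* The system u_t = D lap u + L u + al M u + be B(c) u_x + Q[u,u] + K[u,u,u] for
   u t x y; derive1 is total, so differentiability is required explicitly. *)
Definition solves (c al be : R) (u : R -> R -> R -> 'cV[R]_2) : Prop :=
  forall (t x y : R),
  (forall i : 'I_2,
    [/\ derivable (fun s : R => u s x y i 0) t 1,
        (forall s : R, derivable (fun s : R => u t s y i 0) s 1) /\
        derivable (derive1 (fun s : R => u t s y i 0)) x 1
      & (forall s : R, derivable (fun s : R => u t x s i 0) s 1) /\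
        derivable (derive1 (fun s : R => u t x s i 0)) y 1]) /\
  \col_i derive1 (fun s : R => u s x y i 0) t =
    Dm *m \col_i (derive1 (derive1 (fun s : R => u t s y i 0)) x
                  + derive1 (derive1 (fun s : R => u t x s i 0)) y)
    + Lm S *m u t x y + al *: (Mm S *m u t x y)
    + be *: (advection c *m \col_i derive1 (fun s : R => u t s y i 0) x)
    + bil Q (u t x y) (u t x y) + tri (Kt S) (u t x y) (u t x y) (u t x y).

(* B(c) contains the drift be c, so that a stripe of velocity be c is a steady
   state. *)
Definition stripe (c al be kappa : R) (phi : R -> 'cV[R]_2) : Prop :=
  [/\ solves c al be (fun _ x _ => phi x),
      forall x, phi (x + 2 * pi / kappa) = phi x
    & exists x, phi x != 0].

End Quadratic.

(* The curves, in the unscaled parameters. *)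
Definition Mqh (ka be th : R) : R :=
  - (7 / 4) * rho_be * be ^+ 2 - (th + 1) * rho_ka * ka ^+ 2.

Definition deltaM (ka be q th : R) : R :=
  4 * q ^+ 4 + 9 * k0 * rho_be * be ^+ 2 * q ^+ 2
  + 12 * k0 * th * rho_ka * ka ^+ 2 * q ^+ 2.

Definition sgb (s : bool) : R := if s then 1 else - 1.

Definition MqH (s : bool) (ka be q th : R) : R :=
  Mqh ka be th
  - (3 * k0)^-1 * (2 * q ^+ 2 + sgb s * Num.sqrt (deltaM ka be q th)).

End Model.

Definition o_upto (R : realType) (n : nat) (f : R -> R) : Prop :=
  forall e : R, f e =o_(e \near 0^'+) (e ^+ n).

Definition O_upto (R : realType) (n : nat) (f : R -> R) : Prop :=
  forall e : R, f e =O_(e \near 0^'+) (e ^+ n).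

Definition eq_upto (R : realType) (n : nat) (f g : R -> R) : Prop :=
  o_upto n (fun e => f e - g e).

(* For f = a e^n and g = b e^n with a, b constant this says a <= b. *)
Definition le_upto (R : realType) (n : nat) (f g : R -> R) : Prop :=
  exists2 h : R -> R, o_upto n h & \forall e \near 0^'+, f e <= g e + h e.

(* All quantities may depend on e -> 0+; a boundary in parameter space is
   probed by arbitrary bounded families of scaled parameters. *)
Record qh_family (R : realType) := QhFamily {
  Qf : R -> tensor2 R;
  alp : R -> R;            (* alpha' *)
  bep : R -> R;            (* beta' *)
  kap : R -> R;            (* kappa' *)
  elp : R -> R;            (* ell' *)
  Ap : R -> R;             (* A' *)
  th : R -> R;             (* theta *)
  cv : R -> R;             (* velocity parameter c(mu) *)
  phi : R -> R -> 'cV[R]_2;  (* stripe profile *)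
  rA : R -> R;             (* remainder in the amplitude equation *)
  rlam : R -> R            (* remainder in lambda' *) }.

Section Family.
Variables (R : realType) (S : model R) (F : qh_family R).

Definition alf (e : R) : R := e ^+ 2 * alp F e.
Definition bef (e : R) : R := e * bep F e.
Definition kaf (e : R) : R := e * kap F e.
Definition elf (e : R) : R := e * elp F e.
Definition qf (e : R) : R := qcoef S (Qf F e).

Definition scaling : Prop :=
  [/\ O_upto 0 (alp F), O_upto 0 (bep F), O_upto 0 (kap F), O_upto 0 (elp F)
    & O_upto 0 (Ap F)].

Definition bounded_tensor (Q : R -> tensor2 R) : Prop :=
  forall i j k, O_upto 0 (fun e => Q e i j k).

Definition omega (ka el : R) : R :=
  (9 * el + 15 * ka) * (el - ka) * rho_ka S / 16.

Definition theta_spec : Prop :=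
  \forall e \near 0^'+,
    [/\ elf e != kaf e, 0 < th F e, th F e <= 1
      & omega (kaf e) (elf e) = - th F e * rho_ka S * kaf e ^+ 2].

Definition stripes : Prop :=
  [/\ \forall e \near 0^'+,
        [/\ symmetric2 (Qf F e), rho_nl S (Qf F e) < 0, 0 < Ap F e,
            stripe S (Qf F e) (cv F e) (alf e / lambda_M S) (bef e)
              (kc S + kaf e) (phi F e)
          & e ^+ 2 * (alp F e + rho_be S * bep F e ^+ 2
                      + rho_ka S * kap F e ^+ 2
                      + rho_nl S (Qf F e) * Ap F e ^+ 2 + rA F e) = 0],
      O_upto 1 (rA F),
      O_upto 1 (fun e => cv F e + lambda_be S)
    & exists (x0 : R -> R) (C : R), \forall e \near 0^'+,
        forall (x : R) (i : 'I_2),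
          `|phi F e x i 0
            - 2 * (e * Ap F e) * E0 S i 0 * cos ((kc S + kaf e) * (x - x0 e))|
          <= C * e ^+ 2].

Definition L2qh (e : R) : 'M[R[i]]_2 :=
  L2qh_mx S (Qf F e) e (alp F e) (bep F e) (kap F e) (elp F e) (Ap F e)
    (rlam F e).

(* true is the sign + *)
Definition lambda_qh (s : bool) (e : R) : R[i] :=
  L2qh e 0 0 + (sgb R s)%:C * `|L2qh e 0 1|.

Definition Re_lambda (s : bool) (e : R) : R := complex.Re (lambda_qh s e).

Definition Mqh_f (e : R) : R := Mqh S (kaf e) (bef e) (th F e).

Definition deltaM_f (e : R) : R := deltaM S (kaf e) (bef e) (qf e) (th F e).

Definition MqH_f (s : bool) (e : R) : R :=
  MqH S s (kaf e) (bef e) (qf e) (th F e).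

End Family.

(* Main.v *)
Require Import Defs.
From HB Require Import structures.
From mathcomp Require Import all_boot all_order all_algebra.
From mathcomp Require Import all_classical all_reals all_analysis.
From mathcomp Require Import complex.
From mathcomp Require Import ring lra.

Set Implicit Arguments.
Unset Strict Implicit.
Unset Printing Implicit Defensive.

Import Order.TTheory GRing.Theory Num.Theory.
Import numFieldNormedType.Exports.
Local Open Scope classical_set_scope.
Local Open Scope ring_scope.
(* Divide everything by the powers of e prescribed by the scaling and put
   x = alpha' - Mqh', T = 3/4 rho_be beta'^2 + theta rho_ka kappa'^2 and
   q' = q/e.  Eliminating 3 k0 A'^2 with the amplitude equation gives
   A'^2 = -(x - T)/(3 k0) + o(1) and, by the definition of theta,
   Re lambda_s / e^2 = -x + 2 s A' |q'| + o(1); all other contributions of Q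
   (Q0, Q1, Q2 and p) vanish with Q.  If q' = o(1) this is part (i).  Otherwise
   x = 2 s A' |q'| + o(1) means that s x >= o(1) and x^2 = 4 A'^2 q'^2 + o(1),
   and inserting A'^2 turns the latter into a quadratic equation for x whose
   discriminant is proportional to delta_M. *)

(** * Calculus of o(1) and O(1) quantities as e tends to 0 from the right *)

Definition vanishing (R : realType) (f : R -> R) : Prop :=
  f e @[e --> 0^'+] --> (0 : R).

Definition bounded0 (R : realType) (f : R -> R) : Prop :=
  exists C : R, \forall e \near 0^'+, `|f e| <= C.

Section Asymptotics.
Variable R : realType.
Implicit Types f g h : R -> R.

Lemma vanishingP f :
  vanishing f <-> forall d : R, 0 < d -> \forall e \near 0^'+, `|f e| <= d.
Proof. exact: cvgr0Pnorm_le. Qed.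

Lemma vanishing_le f g :
  (\forall e \near 0^'+, `|f e| <= `|g e|) -> vanishing g -> vanishing f.
Proof.
move=> fg /vanishingP g0; apply/vanishingP => d d0.
by apply: filterS2 fg (g0 d d0) => e; apply: le_trans.
Qed.

Lemma vanishing_near f g :
  (\forall e \near 0^'+, f e = g e) -> vanishing f <-> vanishing g.
Proof.
move=> fg; split; apply: vanishing_le.
  by apply: filterS fg => e ->.
by apply: filterS fg => e ->.
Qed.

Lemma vanishing_norm f : vanishing f -> vanishing (fun e => `|f e|).
Proof. by apply: vanishing_le; apply: nearW => e; rewrite normr_id. Qed.

Lemma vanishing0 : vanishing (fun=> 0 : R).
Proof. exact: cvg_cst. Qed.

Lemma vanishing_id : vanishing (fun e : R => e).
Proof.
apply/vanishingP => d d0.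
by apply: filterS2 (nbhs_right_gt 0) (nbhs_right_le d0) => e /gtr0_norm ->.
Qed.

Lemma vanishingD f g :
  vanishing f -> vanishing g -> vanishing (fun e => f e + g e).
Proof. rewrite /vanishing => f0 g0; have H := cvgD f0 g0; rewrite addr0 in H; exact: H. Qed.

Lemma vanishingN f : vanishing f -> vanishing (fun e => - f e).
Proof. by apply: vanishing_le; apply: nearW => e; rewrite normrN. Qed.

Lemma vanishingB f g :
  vanishing f -> vanishing g -> vanishing (fun e => f e - g e).
Proof. by move=> f0 g0; apply/vanishingD/vanishingN. Qed.

Lemma vanishingM f g :
  vanishing f -> bounded0 g -> vanishing (fun e => f e * g e).
Proof.
move=> /vanishingP f0 [C gC]; apply/vanishingP => d d0.
(* The bound [C] may be 0, or is not known to be positive, so [|C| + 1] serves as divisor. *)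
have C0 : 0 < `|C| + 1 by rewrite ltr_wpDl.
have := f0 _ (divr_gt0 d0 C0); apply: filterS2 gC => e ge fe.
rewrite normrM -(divfK (lt0r_neq0 C0) d) ler_pM //.
by rewrite (le_trans ge)// (le_trans (ler_norm C))// lerDl.
Qed.

Lemma vanishing_sqr f : vanishing (fun e => f e ^+ 2) -> vanishing f.
Proof.
move=> /vanishingP f0; apply/vanishingP => d d0.
apply: filterS (f0 _ (exprn_gt0 2 d0)) => e.
by rewrite normrX ler_sqr ?nnegrE // ltW.
Qed.

Lemma vanishing_bounded0 f : vanishing f -> bounded0 f.
Proof. by move=> /vanishingP f0; exists 1; apply: f0. Qed.

Lemma bounded0_le f g :
  (\forall e \near 0^'+, `|f e| <= `|g e|) -> bounded0 g -> bounded0 f.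
Proof. by move=> fg [C gC]; exists C; apply: filterS2 fg gC => e; apply: le_trans. Qed.

Lemma bounded0_cst (a : R) : bounded0 (fun=> a).
Proof. by exists `|a|; apply: nearW. Qed.

Lemma bounded0D f g :
  bounded0 f -> bounded0 g -> bounded0 (fun e => f e + g e).
Proof.
move=> [C fC] [C' gC]; exists (C + C'); apply: filterS2 fC gC => e fe ge.
by rewrite (le_trans (ler_normD _ _))// lerD.
Qed.

Lemma bounded0N f : bounded0 f -> bounded0 (fun e => - f e).
Proof. by apply: bounded0_le; apply: nearW => e; rewrite normrN. Qed.

Lemma bounded0B f g :
  bounded0 f -> bounded0 g -> bounded0 (fun e => f e - g e).
Proof. by move=> f0 g0; apply/bounded0D/bounded0N. Qed.

Lemma bounded0_norm f : bounded0 f -> bounded0 (fun e => `|f e|).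
Proof. by apply: bounded0_le; apply: nearW => e; rewrite normr_id. Qed.

Lemma bounded0M f g :
  bounded0 f -> bounded0 g -> bounded0 (fun e => f e * g e).
Proof.
move=> [C fC] [C' gC]; exists (C * C'); apply: filterS2 fC gC => e fe ge.
by rewrite normrM ler_pM.
Qed.

Lemma bounded0X f n : bounded0 f -> bounded0 (fun e => f e ^+ n).
Proof.
move=> f0; elim: n => [|n IH].
  by under eq_fun do rewrite expr0; apply: bounded0_cst.
by under eq_fun do rewrite exprS; apply: bounded0M.
Qed.

Lemma bounded0_sqrt f : bounded0 f -> bounded0 (fun e => Num.sqrt (f e)).
Proof.
move=> [C fC]; exists (Num.sqrt `|C|); apply: filterS fC => e fe.
rewrite ger0_norm ?sqrtr_ge0 // ler_wsqrtr // (le_trans (ler_norm _)) //.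
by rewrite (le_trans fe) // ler_norm.
Qed.

Lemma bounded0_sum (I : finType) (f : I -> R -> R) :
  (forall i, bounded0 (f i)) -> bounded0 (fun e => \sum_i f i e).
Proof.
move=> f0; elim: (index_enum I) => [|i s IH].
  by apply: bounded0_le (bounded0_cst 0); apply: nearW => e; rewrite big_nil.
apply: bounded0_le (bounded0D (f0 i) IH).
by apply: nearW => e; rewrite big_cons.
Qed.

(** The pointwise equations in [o_upto] say that [f] is its own littleo representative. Function
    extensionality gives the equality of functions to which [eqoP] applies, and e > 0 near the limit
    allows the division. *)
Lemma o_uptoP n f : o_upto n f <-> vanishing (fun e => f e / e ^+ n).
Proof.
split=> [/funext/eqoP H|/vanishingP H].
  apply/vanishingP => d /H; apply: filterS2 (nbhs_right_gt 0) => e e0.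
  by rewrite normf_div ler_pdivrMr // normr_gt0 expf_neq0 ?gt_eqF.
suff /eqoP E : forall d : R, 0 < d -> \forall e \near 0^'+, `|f e| <= d * `|e ^+ n|.
  by move=> e; rewrite {1}E.
move=> d /H; apply: filterS2 (nbhs_right_gt 0) => e e0.
by rewrite normf_div ler_pdivrMr // normr_gt0 expf_neq0 ?gt_eqF.
Qed.

Lemma O_upto0P f : O_upto 0 f -> bounded0 f.
Proof.
move=> /funext/eqO_exP[C _ fC].
by exists C; apply: filterS fC => e; rewrite expr0 normr1 mulr1.
Qed.

Lemma O_upto1_vanishing f : O_upto 1 f -> vanishing f.
Proof.
move=> /funext/eqO_exP[C C0 fC].
apply: vanishing_le (vanishingM vanishing_id (bounded0_cst C)).
by apply: filterS fC => e; rewrite expr1 normrM (gtr0_norm C0) mulrC.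
Qed.

(** Passage from unscaled to primed quantities: after division by e^n, leading-order equality
    becomes a difference tending to 0. The factorisations need only hold near 0+, since q/e makes no
    sense at e = 0. *)
Lemma eq_uptoP n (f g f' g' : R -> R) :
  (\forall e \near 0^'+, f e = e ^+ n * f' e) ->
  (\forall e \near 0^'+, g e = e ^+ n * g' e) ->
  eq_upto n f g <-> vanishing (fun e => f' e - g' e).
Proof.
move=> ff gg; apply: iff_trans (o_uptoP _ _) _; apply: vanishing_near.
near=> e; have e0 : 0 < e by near: e; exact: nbhs_right_gt.
have -> : f e = e ^+ n * f' e by near: e.
have -> : g e = e ^+ n * g' e by near: e.
by rewrite -mulrBr mulrC mulKf // expf_neq0 // gt_eqF.
Unshelve. all: by end_near. Qed.

Lemma le_uptoP n (f g f' g' : R -> R) :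
  (\forall e \near 0^'+, f e = e ^+ n * f' e) ->
  (\forall e \near 0^'+, g e = e ^+ n * g' e) ->
  le_upto n f g <->
  exists2 h, vanishing h & \forall e \near 0^'+, f' e <= g' e + h e.
Proof.
move=> ff gg; split=> -[h h0 hle].
  exists (fun e => h e / e ^+ n); first exact/o_uptoP.
  near=> e; have e0 : 0 < e by near: e; exact: nbhs_right_gt.
  have en0 : 0 < e ^+ n by rewrite exprn_gt0.
  rewrite -(ler_pM2l en0) mulrDr mulrCA mulfV ?gt_eqF // mulr1.
  by near: e; apply: filterS3 ff gg hle => e -> ->.
exists (fun e => e ^+ n * h e).
  apply/o_uptoP; apply: vanishing_le h0; near=> e; have e0 : 0 < e by near: e; exact: nbhs_right_gt.
  by rewrite mulrC mulKf // expf_neq0 // gt_eqF.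
near=> e; have e0 : 0 < e by near: e; exact: nbhs_right_gt.
have -> : f e = e ^+ n * f' e by near: e.
have -> : g e = e ^+ n * g' e by near: e.
rewrite -mulrDr ler_pM2l ?exprn_gt0 //.
by near: e.
Unshelve. all: by end_near. Qed.

End Asymptotics.

(** * The quadratic equation behind case (ii), for abstract real families *)

Section AbstractBoundary.
Variable R : realType.
Implicit Types f g X T A q : R -> R.

Lemma sgbM (s : bool) : sgb R s * sgb R s = 1.
Proof. by case: s; rewrite /sgb ?mulrNN mulr1. Qed.

Lemma normr_sgb (s : bool) : `|sgb R s| = 1.
Proof. by case: s; rewrite /sgb ?normrN normr1. Qed.

Lemma vanishing_sgb (s : R -> bool) f :
  vanishing (fun e => sgb R (s e) * f e) <-> vanishing f.
Proof.
by split; apply: vanishing_le; apply: nearW => e; rewrite normrM normr_sgb mul1r.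
Qed.

(* As g >= 0, the square of | |f| - g | is at most |f^2 - g^2|. *)
Lemma vanishing_normB f g :
  (\forall e \near 0^'+, 0 <= g e) ->
  vanishing (fun e => f e ^+ 2 - g e ^+ 2) -> vanishing (fun e => `|f e| - g e).
Proof.
move=> g0 fg; apply: vanishing_sqr; apply: vanishing_le fg.
apply: filterS g0 => e ge; rewrite normrX expr2 -(real_normK (num_real (f e))).
have fe := normr_ge0 (f e).
rewrite subr_sqr normrM ler_wpM2l // [leRHS]ger0_norm ?addr_ge0 // ler_norml.
by apply/andP; split; lra.
Qed.

(* Num.sqrt is 0 on negative reals, so no sign condition on g is needed. *)
Lemma vanishing_normB_sqrt f g :
  vanishing (fun e => f e ^+ 2 - g e) ->
  vanishing (fun e => `|f e| - Num.sqrt (g e)).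
Proof.
move=> fg; apply: vanishing_normB; first by apply: nearW => e; apply: sqrtr_ge0.
apply: vanishing_le fg; apply: nearW => e; have [g0|g0] := lerP 0 (g e).
  by rewrite sqr_sqrtr.
rewrite (ler0_sqrtr (ltW g0)) expr0n /= subr0 ger0_norm ?sqr_ge0 //.
by apply: le_trans (ler_norm _); lra.
Qed.

(** The two sides differ only where f < 0; there the square root is 0 and the error is -f <= h. *)
Lemma vanishing_sqrt_sqrB f h :
  vanishing h -> (\forall e \near 0^'+, 0 <= f e + h e) ->
  vanishing (fun e => Num.sqrt (f e) ^+ 2 - f e).
Proof.
move=> h0 fh; apply: vanishing_le h0; apply: filterS fh => e fe.
have [f0|f0] := lerP 0 (f e); first by rewrite sqr_sqrtr // subrr normr0.
rewrite (ler0_sqrtr (ltW f0)) expr0n /= sub0r normrN ltr0_norm //.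
by apply: le_trans (ler_norm _); lra.
Qed.

(** If s f >= 0 the difference is 0; otherwise it is -2 s f, which is at most 2 h. *)
Lemma vanishing_normB_sgb (s : bool) f h :
  vanishing h -> (\forall e \near 0^'+, 0 <= sgb R s * f e + h e) ->
  vanishing (fun e => `|f e| - sgb R s * f e).
Proof.
move=> h0 fh; apply: vanishing_le (vanishingM h0 (bounded0_cst 2)).
apply: filterS fh => e; set x := f e; set y := h e => xy.
have -> : `|x| = `|sgb R s * x| by rewrite normrM normr_sgb mul1r.
move: xy; set z := sgb R s * x => zy.
have [z0|z0] := leP 0 z; first by rewrite (ger0_norm z0) subrr normr0.
rewrite (ltr0_norm z0) ger0_norm; last by lra.
by apply: le_trans (ler_norm _); lra.
Qed.

(** Completing the square: with Z = 3 k X + 2 q^2 and r = 2 A |q|, the amplitude relation turns X^2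
    = r^2 + o(1) into Z^2 = delta + o(1). Squaring forgets the sign of X, which the second clause
    restores; the third excludes parameters where [Num.sqrt] returns 0 because delta is
    substantially negative. *)
Lemma quadratic_boundary (k : R) (s : bool) X T A q :
  k < 0 ->
  bounded0 X -> bounded0 T -> bounded0 A -> bounded0 q ->
  (\forall e \near 0^'+, 0 <= A e) ->
  vanishing (fun e => A e ^+ 2 + (X e - T e) / (3 * k)) ->
  let delta e := 4 * q e ^+ 4 + 12 * k * q e ^+ 2 * T e in
  vanishing (fun e => X e - sgb R s * (2 * A e * `|q e|)) <->
  [/\ exists t : R -> bool, vanishing (fun e =>
        X e + (3 * k)^-1 * (2 * q e ^+ 2 + sgb R (t e) * Num.sqrt (delta e))),
      exists2 h, vanishing h & \forall e \near 0^'+, 0 <= sgb R s * X e + h e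
    & exists2 h, vanishing h & \forall e \near 0^'+, 0 <= delta e + h e].
Proof.
move=> k0 bX bT bA bq A0 amp delta.
have kn0 : k != 0 by rewrite lt_eqF.
pose r e := 2 * A e * `|q e|; pose Z e := 3 * k * X e + 2 * q e ^+ 2.
have br : bounded0 r.
  by apply: bounded0M (bounded0_norm bq); apply: bounded0M bA; apply: bounded0_cst.
have bq2 : bounded0 (fun e => q e ^+ 2) by apply: bounded0X.
have bZ : bounded0 Z.
  apply: bounded0D; first by apply: bounded0M bX; apply: bounded0_cst.
  by apply: bounded0M bq2; apply: bounded0_cst.
have bd : bounded0 delta.
  apply: bounded0D; first by apply: bounded0M (bounded0X _ bq); apply: bounded0_cst.
  by apply: bounded0M bT; apply: bounded0M bq2; apply: bounded0_cst.
have r0 : \forall e \near 0^'+, 0 <= r e.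
  by apply: filterS A0 => e Ae; rewrite !mulr_ge0.
(* The left-hand side is exactly 36 k^2 q^2 times the residual of the amplitude relation. *)
have dZ : vanishing (fun e =>
    Z e ^+ 2 - delta e - 9 * k ^+ 2 * (X e ^+ 2 - r e ^+ 2)).
  apply: vanishing_le (vanishingM amp (bounded0M (bounded0_cst (36 * k ^+ 2)) bq2)).
  apply: nearW => e; rewrite le_eqVlt; apply/orP; left; apply/eqP; congr `|_|.
  rewrite /Z /delta /r !exprMn real_normK ?num_real //.
  by field.
have disc : vanishing (fun e => Z e ^+ 2 - delta e) <->
            vanishing (fun e => X e ^+ 2 - r e ^+ 2).
  split=> H.
    have := vanishingM (vanishingB H dZ) (bounded0_cst (9 * k ^+ 2)^-1).
    by apply: vanishing_le; apply: nearW => e; rewrite subKr mulrC mulKf // mulf_neq0 ?expf_neq0.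
  have := vanishingD dZ (vanishingM H (bounded0_cst (9 * k ^+ 2))).
  apply: vanishing_le; apply: nearW => e.
  by rewrite (mulrC (X e ^+ 2 - _)) subrK.
split.
  move=> HX.
  (* Since s^2 = 1, this is (X - s r)(X + s r) with a bounded second factor. *)
  have XX : vanishing (fun e => X e ^+ 2 - r e ^+ 2).
    have b : bounded0 (fun e => X e + sgb R s * r e).
      by apply: bounded0D bX _; apply: bounded0M br; apply: bounded0_cst.
    apply: vanishing_le (vanishingM HX b); apply: nearW => e.
    have := sgbM s; rewrite -/(r e); set u := sgb R s => uu.
    by rewrite -subr_sqr [(u * _) ^+ 2]exprMn [u ^+ 2]expr2 uu mul1r.
  have Zd := disc.2 XX; split.
  (* From |Z| = sqrt delta + o(1), the sign of Z selects the root: Z + sqrt delta = o(1) where Z <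
     0, and Z - sqrt delta = o(1) elsewhere. This sign may change with e, so the choice of curve is
     a function of e. *)
  - exists (fun e => Z e < 0).
    apply: vanishing_le (vanishingM (vanishing_normB_sqrt Zd) (bounded0_cst (3 * k)^-1)).
    apply: nearW => e; rewrite !normrM.
    have -> : X e + (3 * k)^-1 * (2 * q e ^+ 2 + sgb R (Z e < 0) * Num.sqrt (delta e))
      = (3 * k)^-1 * (Z e + sgb R (Z e < 0) * Num.sqrt (delta e)) by rewrite /Z; field.
    rewrite normrM mulrC ler_wpM2r //.
    case: ltP => Z0; rewrite /sgb.
      by rewrite (ltr0_norm Z0) mul1r -normrN opprD.
    by rewrite (ger0_norm Z0) mulN1r.
  (* Here s X = r + s (X - s r), and r >= 0. *)
  - exists (fun e => `|X e - sgb R s * r e|); first exact: vanishing_norm.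
    apply: filterS r0 => e re.
    rewrite -[X in `|X|]mul1r -(sgbM s) -mulrA normrM normr_sgb mul1r mulrBr mulrA sgbM mul1r.
    by have := ler_norm (- (sgb R s * X e - r e)); rewrite normrN; lra.
  (* Adding this error to delta gives at least Z^2. *)
  - exists (fun e => `|Z e ^+ 2 - delta e|); first exact: vanishing_norm.
    apply: nearW => e; have := ler_norm (Z e ^+ 2 - delta e); have := sqr_ge0 (Z e); lra.
move=> [[t Ht] [h h0 Xh] [h' h'0 dh]].
(* With w = sqrt delta and u the chosen sign, Z^2 - delta = (Z + u w)(Z - u w) + (w^2 - delta). The
   curve makes the first product small, and near-nonnegativity of delta the last term. *)
have Zd : vanishing (fun e => Z e ^+ 2 - delta e).
  have b : bounded0 (fun e => (3 * k) * (Z e - sgb R (t e) * Num.sqrt (delta e))).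
    apply: bounded0M (bounded0_cst _) (bounded0B bZ _).
    apply: bounded0M (bounded0_sqrt bd).
    by exists 1; apply: nearW => e; rewrite normr_sgb.
  apply: vanishing_le (vanishingD (vanishingM Ht b) (vanishing_sqrt_sqrB h'0 dh)).
  apply: nearW => e; rewrite le_eqVlt; apply/orP; left; apply/eqP; congr `|_|.
  have := sgbM (t e); set u := sgb R (t e); set w := Num.sqrt _ => uu.
  have -> : X e + (3 * k)^-1 * (2 * q e ^+ 2 + u * w)
      = (3 * k)^-1 * (Z e + u * w) by rewrite /Z; field.
  rewrite mulrACA mulVf ?mulf_neq0 // mul1r.
  transitivity (Z e ^+ 2 - u * u * w ^+ 2 + (w ^+ 2 - delta e)); last by ring.
  by rewrite uu; ring.
(* Now |X| - r and |X| - s X both tend to 0, hence so does s X - r. *)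
have Xr := vanishing_normB r0 (disc.1 Zd).
apply/(vanishing_sgb (fun=> s)).
have := vanishingB Xr (vanishing_normB_sgb h0 Xh).
apply: vanishing_le; apply: nearW => e.
rewrite mulrBr (mulrA (sgb R s) (sgb R s)) sgbM mul1r -/(r e).
by rewrite le_eqVlt; apply/orP; left; apply/eqP; congr `|_|; ring.
Qed.

End AbstractBoundary.

(** * Multilinear algebra and the restricted inverse of [Nc] *)

Section LinearAlgebra.

Lemma bilDl (T : comNzRingType) (q : tensor2 T) (u u' v : 'cV[T]_2) :
  bil q (u + u') v = bil q u v + bil q u' v.
Proof.
apply/colP => i; rewrite !mxE -big_split; apply: eq_bigr => j _ /=.
by rewrite -big_split; apply: eq_bigr => k _ /=; rewrite mxE mulrDr mulrDl.
Qed.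

Lemma bilZl (T : comNzRingType) (q : tensor2 T) (a : T) (u v : 'cV[T]_2) :
  bil q (a *: u) v = a *: bil q u v.
Proof.
apply/colP => i; rewrite !mxE mulr_sumr; apply: eq_bigr => j _.
by rewrite mulr_sumr; apply: eq_bigr => k _; rewrite mxE mulrCA !mulrA.
Qed.

Lemma bil_scale (T : comNzRingType) (q : tensor2 T) (a : T) (u v : 'cV[T]_2) :
  bil (fun i j k => a * q i j k) u v = a *: bil q u v.
Proof.
apply/colP => i; rewrite !mxE mulr_sumr; apply: eq_bigr => j _.
by rewrite mulr_sumr; apply: eq_bigr => k _; rewrite !mulrA.
Qed.

Lemma map_bil (T U : comNzRingType) (f : {rmorphism T -> U}) (q : tensor2 T)
    (u v : 'cV[T]_2) :
  bil (fun i j k => f (q i j k)) (map_mx f u) (map_mx f v) = map_mx f (bil q u v).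
Proof.
apply/colP => i; rewrite !mxE rmorph_sum; apply: eq_bigr => j _.
by rewrite rmorph_sum; apply: eq_bigr => k _; rewrite !mxE !rmorphM.
Qed.

Lemma dotE (T : comNzRingType) (u v : 'cV[T]_2) : dot u v = (v^T *m u) 0 0.
Proof. by rewrite mxE; apply: eq_bigr => i _; rewrite mxE mulrC. Qed.

Lemma dotDl (T : comNzRingType) (u u' v : 'cV[T]_2) :
  dot (u + u') v = dot u v + dot u' v.
Proof. by rewrite !dotE mulmxDr mxE. Qed.

Lemma dotZl (T : comNzRingType) (a : T) (u v : 'cV[T]_2) :
  dot (a *: u) v = a * dot u v.
Proof. by rewrite !dotE -scalemxAr mxE. Qed.

Lemma dotNl (T : comNzRingType) (u v : 'cV[T]_2) : dot (- u) v = - dot u v.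
Proof. by rewrite -scaleN1r dotZl mulN1r. Qed.

Lemma map_dot (T U : comNzRingType) (f : {rmorphism T -> U}) (u v : 'cV[T]_2) :
  dot (map_mx f u) (map_mx f v) = f (dot u v).
Proof. by rewrite rmorph_sum; apply: eq_bigr => i _; rewrite !mxE rmorphM. Qed.

Lemma qcoef_scale (R : realType) (S : model R) (Q : tensor2 R) (a : R) :
  qcoef S (fun i j k => a * Q i j k) = a * qcoef S Q.
Proof. by rewrite /qcoef bil_scale dotZl. Qed.

(* The rank one correction E0 E0s^T makes Nc invertible, and it does not act on
   the preimages selected by Nc_inv. *)
Definition bordered (R : realType) (S : model R) : 'M[R]_2 :=
  Nc S + E0 S *m (E0s S)^T.

Section Critical.
Variables (R : realType) (S : model R).
Hypothesis hE : critical_vectors S.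

Lemma E0s_tr_Nc : (E0s S)^T *m Nc S = 0.
Proof.
have [_ hs _ _] := hE; have /hs : exists a, E0s S = a *: E0s S.
  by exists 1; rewrite scale1r.
by move/(congr1 trmx); rewrite trmx_mul trmxK trmx0.
Qed.

Lemma bordered_mul (w : 'cV[R]_2) :
  bordered S *m w = Nc S *m w + dot w (E0s S) *: E0 S.
Proof. by rewrite mulmxDl -mulmxA [(E0s S)^T *m w]mx11_scalar -dotE mul_mx_scalar. Qed.

(** The range of [Nc] is orthogonal to [E0s], and <E0, E0s> = 1. *)
Lemma dot_bordered (w : 'cV[R]_2) : dot (bordered S *m w) (E0s S) = dot w (E0s S).
Proof.
rewrite bordered_mul dotDl dotZl [dot (Nc S *m w) _]dotE mulmxA E0s_tr_Nc.
by have [_ _ _ h] := hE; rewrite mul0mx mxE add0r h mulr1.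
Qed.

(** A kernel vector v has <v, E0s> = 0 by [dot_bordered], so [Nc] kills it and v = a E0; pairing
    with [E0s] gives a = 0. The transpose is taken because [det0P] yields a row vector. *)
Lemma bordered_unit : bordered S \in unitmx.
Proof.
rewrite -unitmx_tr unitmxE unitfE; apply/det0P => -[v v0 vP].
have Pv : bordered S *m v^T = 0 by rewrite -[LHS]trmxK trmx_mul trmxK vP trmx0.
have dv : dot v^T (E0s S) = 0 by rewrite -dot_bordered Pv dotE mulmx0 mxE.
have := bordered_mul v^T; rewrite Pv dv scale0r addr0 => /esym.
have [hN _ _ hd] := hE; case/hN => a va.
move: dv; rewrite va dotZl hd mulr1 => a0.
by move/negP: v0; apply; rewrite -[v]trmxK va a0 scale0r trmx0.
Qed.

(** Replaces the choice made by [xget] with a fixed matrix, so that smallness of v passes to its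
    preimage. *)
Lemma Nc_invE (v : 'cV[R]_2) :
  dot v (E0s S) = 0 -> Nc_inv S v = invmx (bordered S) *m v.
Proof.
move=> dv; apply: xget_unique => [|w [<- dw]] /=.
  have dw : dot (invmx (bordered S) *m v) (E0s S) = 0.
    by rewrite -dot_bordered mulKVmx // bordered_unit.
  split=> //; have := bordered_mul (invmx (bordered S) *m v).
  by rewrite mulKVmx ?bordered_unit // dw scale0r addr0.
by rewrite -[LHS](mulKmx bordered_unit) bordered_mul dw scale0r addr0.
Qed.

Lemma Q1E (Q : tensor2 R) :
  Q1 S Q = invmx (bordered S) *m (qcoef S Q *: E0 S - bil Q (E0 S) (E0 S)).
Proof.
apply: Nc_invE; have [_ _ _ h] := hE.
by rewrite dotDl dotNl dotZl h mulr1 subrr.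
Qed.

End Critical.

Definition pcoef_re (R : realType) (S : model R) (Q : tensor2 R) (ka el : R) : R :=
  dot (bil Q ((5 / 2 * ka + 3 / 2 * el) *: w_ka S) (E0 S)
       - ((ka + 3 * el) * kc S) *: (Dm S *m Q1 S Q)) (E0s S).

Definition pcoef_im (R : realType) (S : model R) (Q : tensor2 R) (be : R) : R :=
  dot (bil Q (be *: w_be S) (E0 S) - (be * kc S) *: (B0 S *m Q1 S Q)) (E0s S).

(** All vectors and tensors involved are real, so the embedding into the complex numbers commutes
    with every operation; i enters only as a factor of [be]. *)
Lemma pcoefE (R : realType) (S : model R) (Q : tensor2 R) (be ka el : R) :
  pcoef S Q be ka el =
  real_complex R (pcoef_re S Q ka el) + 'i%C * real_complex R (pcoef_im S Q be).
Proof.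
rewrite /pcoef /pcoef_re /pcoef_im; move: (w_ka S) (w_be S) (Q1 S Q) => wk wb v.
rewrite bilDl !bilZl mulmxDl -!scalemxAl -!map_mxM !map_bil.
rewrite !dotDl !dotNl !dotDl !dotZl !map_dot.
rewrite !rmorphD !rmorphN !rmorphM /=.
by ring.
Qed.

End LinearAlgebra.

(** * Bounded and vanishing families of vectors *)

Section BoundedVectors.
Variable R : realType.

Definition bounded0_cV (v : R -> 'cV[R]_2) := forall i, bounded0 (fun e => v e i 0).
Definition vanishing_cV (v : R -> 'cV[R]_2) := forall i, vanishing (fun e => v e i 0).

Lemma vanishing_sum (I : finType) (f : I -> R -> R) :
  (forall i, vanishing (f i)) -> vanishing (fun e => \sum_i f i e).
Proof.
move=> f0; elim: (index_enum I) => [|i s IH].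
  by under eq_fun do rewrite big_nil; apply: vanishing0.
by under eq_fun do rewrite big_cons; apply: vanishingD.
Qed.

Lemma vanishing_cV_bounded0 v : vanishing_cV v -> bounded0_cV v.
Proof. by move=> v0 i; apply: vanishing_bounded0. Qed.

Lemma bounded0_cV_cst (v : 'cV[R]_2) : bounded0_cV (fun=> v).
Proof. by move=> i; apply: bounded0_cst. Qed.

Lemma bounded0_cVZ a v :
  bounded0 a -> bounded0_cV v -> bounded0_cV (fun e => a e *: v e).
Proof. by move=> ba bv i; under eq_fun do rewrite mxE; apply: bounded0M. Qed.

Lemma vanishing_cVB u v :
  vanishing_cV u -> vanishing_cV v -> vanishing_cV (fun e => u e - v e).
Proof. by move=> bu bv i; under eq_fun do rewrite !mxE; apply: vanishingB. Qed.

Lemma vanishing_cVZl a v :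
  vanishing a -> bounded0_cV v -> vanishing_cV (fun e => a e *: v e).
Proof. by move=> ba bv i; under eq_fun do rewrite mxE; apply: vanishingM. Qed.

Lemma vanishing_cVZr a v :
  bounded0 a -> vanishing_cV v -> vanishing_cV (fun e => a e *: v e).
Proof. by move=> ba bv i; under eq_fun do rewrite mxE mulrC; apply: vanishingM. Qed.

Lemma vanishing_mulmx (A : 'M[R]_2) v :
  vanishing_cV v -> vanishing_cV (fun e => A *m v e).
Proof.
move=> bv i; under eq_fun do rewrite mxE; apply: vanishing_sum => j.
by under eq_fun do rewrite mulrC; apply: vanishingM (bv j) (bounded0_cst _).
Qed.

Lemma vanishing_dot u v :
  vanishing_cV u -> bounded0_cV v -> vanishing (fun e => dot (u e) (v e)).
Proof. by move=> bu bv; apply: vanishing_sum => i; apply: vanishingM. Qed.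

Lemma bounded0_dot u v :
  bounded0_cV u -> bounded0_cV v -> bounded0 (fun e => dot (u e) (v e)).
Proof. by move=> bu bv; apply: bounded0_sum => i; apply: bounded0M. Qed.

Lemma vanishing_bil (q : R -> tensor2 R) u v :
  (forall i j k, vanishing (fun e => q e i j k)) ->
  bounded0_cV u -> bounded0_cV v -> vanishing_cV (fun e => bil (q e) (u e) (v e)).
Proof.
move=> bq bu bv i; under eq_fun do rewrite mxE.
apply: vanishing_sum => j; apply: vanishing_sum => k.
by apply: vanishingM (bv k); apply: vanishingM (bu j).
Qed.

Lemma bounded0_bil (q : R -> tensor2 R) u v :
  (forall i j k, bounded0 (fun e => q e i j k)) ->
  bounded0_cV u -> bounded0_cV v -> bounded0_cV (fun e => bil (q e) (u e) (v e)).
Proof.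
move=> bq bu bv i; under eq_fun do rewrite mxE.
apply: bounded0_sum => j; apply: bounded0_sum => k.
by apply: bounded0M (bv k); apply: bounded0M (bu j).
Qed.

End BoundedVectors.

(** * The coefficients built from Q tend to 0 with Q *)

Section SmallNonlinearity.
Variables (R : realType) (S : model R) (Q : R -> tensor2 R).
Hypothesis hE : critical_vectors S.
Hypothesis Q_small : forall i j k, vanishing (fun e => Q e i j k).

Local Notation cst v := (bounded0_cV_cst v).

Let QE0 : vanishing_cV (fun e => bil (Q e) (E0 S) (E0 S)).
Proof. exact: vanishing_bil Q_small (cst _) (cst _). Qed.

Lemma vanishing_qcoef : vanishing (fun e => qcoef S (Q e)).
Proof. exact: vanishing_dot QE0 (cst _). Qed.

Lemma vanishing_Q1 : vanishing_cV (fun e => Q1 S (Q e)).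
Proof.
under eq_fun do rewrite (Q1E hE); apply: vanishing_mulmx.
exact: vanishing_cVB (vanishing_cVZl vanishing_qcoef (cst _)) QE0.
Qed.

Let vanishing_dot_bil v :
  vanishing_cV v -> vanishing (fun e => dot (bil (Q e) (E0 S) (v e)) (E0s S)).
Proof.
move=> /vanishing_cV_bounded0 bv.
exact: vanishing_dot (vanishing_bil Q_small (cst _) bv) (cst _).
Qed.

Lemma vanishing_q0 : vanishing (fun e => q0 S (Q e)).
Proof.
apply: vanishing_dot_bil.
exact: vanishing_cVZr (bounded0_cst _) (vanishing_mulmx _ QE0).
Qed.

Lemma vanishing_q1 : vanishing (fun e => q1 S (Q e)).
Proof. exact: vanishing_dot_bil vanishing_Q1. Qed.

Lemma vanishing_q2 : vanishing (fun e => q2 S (Q e)).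
Proof.
apply: vanishing_dot_bil.
exact: vanishing_cVZr (bounded0_cst _) (vanishing_mulmx _ QE0).
Qed.

(** The modulus is at most |Re| + |Im|, and both parts are linear in the pair (Q, Q1). The modulus
    is taken as the real-valued [normc], because [vanishing] concerns real families. *)
Lemma vanishing_pcoef (be ka el : R -> R) :
  bounded0 be -> bounded0 ka -> bounded0 el ->
  vanishing (fun e => ComplexField.Normc.normc (pcoef S (Q e) (be e) (ka e) (el e))).
Proof.
move=> bbe bka bel.
have bc (c : R) := bounded0_cst c.
have re0 : vanishing (fun e => pcoef_re S (Q e) (ka e) (el e)).
  apply: vanishing_dot (cst _); apply: vanishing_cVB.
    apply: vanishing_bil Q_small _ (cst _); apply: bounded0_cVZ (cst _).
    exact: bounded0D (bounded0M (bc _) bka) (bounded0M (bc _) bel).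
  apply: vanishing_cVZr (vanishing_mulmx _ vanishing_Q1).
  exact: bounded0M (bounded0D bka (bounded0M (bc _) bel)) (bc _).
have im0 : vanishing (fun e => pcoef_im S (Q e) (be e)).
  apply: vanishing_dot (cst _); apply: vanishing_cVB.
    exact: vanishing_bil Q_small (bounded0_cVZ bbe (cst _)) (cst _).
  exact: vanishing_cVZr (bounded0M bbe (bc _)) (vanishing_mulmx _ vanishing_Q1).
apply: vanishing_le (vanishingD (vanishing_norm re0) (vanishing_norm im0)).
apply: nearW => e; rewrite pcoefE.
have nR (x : R) : ComplexField.Normc.normc (real_complex R x) = `|x|.
  by rewrite /= expr0n /= addr0 sqrtr_sqr.
set a := pcoef_re _ _ _ _; set b := pcoef_im _ _ _.
have n0 (z : R[i]%C) : 0 <= ComplexField.Normc.normc z.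
  by case: z => x y; apply: sqrtr_ge0.
rewrite (ger0_norm (n0 _)) [leRHS]ger0_norm ?addr_ge0 //.
apply: le_trans (le_normcD _ _) _.
by rewrite ComplexField.Normc.normcM !nR /= expr0n expr1n add0r sqrtr1 mul1r.
Qed.

End SmallNonlinearity.

(** * Eigenvalues of a 2x2 matrix with equal diagonal and conjugate off-diagonal entries *)

Lemma det_mx22 (T : comNzRingType) (A : 'M[T]_2) :
  \det A = A 0 0 * A 1 1 - A 0 1 * A 1 0.
Proof.
rewrite (expand_det_row _ 0) !big_ord_recl big_ord0 /cofactor !det_mx11 !mxE /=.
have -> : lift 0 0 = 1 :> 'I_2 by apply/val_inj.
have -> : lift 1 0 = 0 :> 'I_2 by apply/val_inj.
by rewrite /= expr0 expr1; ring.
Qed.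

(** With a on the diagonal and b off it, the determinant is the difference of squares (X - a)^2 -
    |b|^2. *)
Lemma char_poly_herm22 (R : realType) (A : 'M[R[i]]_2) :
  A 1 1 = A 0 0 -> A 1 0 = conjc (A 0 1) ->
  char_poly A = ('X - (A 0 0 + `|A 0 1|)%:P) * ('X - (A 0 0 - `|A 0 1|)%:P).
Proof.
move=> A11 A10; rewrite /char_poly det_mx22 !mxE /= A11 A10.
rewrite !mulr1n !mulr0n !sub0r mulrNN -polyCM -sqr_normc !polyCD polyCN expr2 polyCM.
by ring.
Qed.

(** * Explicit eigenvalues of [L2qh] *)

Section Reduction.
Variables (R : realType) (S : model R) (F : qh_family R).
Local Notation normc := (@ComplexField.Normc.normc R).

Lemma normcR (x : R) : normc (real_complex R x) = `|x|.
Proof. by rewrite /= expr0n /= addr0 sqrtr_sqr. Qed.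

(** Reverse triangle inequality, used with x = 2 q/e and z = p to replace the off-diagonal modulus
    by 2 |q/e|. *)
Lemma normc_addR (x : R) (z : R[i]) :
  `|normc (real_complex R x + z) - `|x| | <= normc z.
Proof.
rewrite -normcR ler_norml; apply/andP; split.
  have := le_normcD (real_complex R x + z) (- z).
  by rewrite addrK normcN; lra.
by have := le_normcD (real_complex R x) z; lra.
Qed.

Lemma L2qh_offdiag (e : R) :
  L2qh S F e 0 1 = real_complex R (e ^+ 2 * Ap F e) *
    (real_complex R (2 * (qf S F e / e))
     + pcoef S (Qf F e) (bep F e) (kap F e) (elp F e)).
Proof.
rewrite !mxE /= !rmorphM /=.
by ring.
Qed.

Lemma L2qh_herm (e : R) : L2qh S F e 1 0 = conjc (L2qh S F e 0 1).
Proof.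
rewrite !mxE /=; case: pcoef => a b /=.
by apply/eqP; rewrite eq_complex /= ?mul0r ?mulr0; apply/andP; split; apply/eqP; ring.
Qed.

Lemma char_poly_L2qh (e : R) :
  char_poly (L2qh S F e) =
  ('X - (lambda_qh S F true e)%:P) * ('X - (lambda_qh S F false e)%:P).
Proof.
rewrite char_poly_herm22 ?L2qh_herm //; last by rewrite !mxE.
by rewrite /lambda_qh /sgb mul1r rmorphN1 mulN1r.
Qed.

Lemma Re_lambdaE (s : bool) (e : R) : 0 <= e -> 0 <= Ap F e ->
  Re_lambda S F s e =
  e ^+ 2 * (lambda_prime S (alp F e) (bep F e) (kap F e) (elp F e) (rlam F e)
            + Ap F e ^+ 2 * Defs.eta S (Qf F e)
            + sgb R s * (Ap F e * normc (real_complex R (2 * (qf S F e / e))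
               + pcoef S (Qf F e) (bep F e) (kap F e) (elp F e)))).
Proof.
move=> e0 A0; rewrite /Re_lambda /lambda_qh L2qh_offdiag normrM.
set z := (real_complex R _ + _).
have nE (w : R[i]) : `|w| = real_complex R (normc w) by [].
rewrite !nE normcR ger0_norm; last by rewrite mulr_ge0 ?sqr_ge0.
have -> : L2qh S F e 0 0 = real_complex R (e ^+ 2 *
    (lambda_prime S (alp F e) (bep F e) (kap F e) (elp F e) (rlam F e)
     + Ap F e ^+ 2 * Defs.eta S (Qf F e))).
  by rewrite !mxE /= -rmorphM.
by move: (normc z) => n /=; ring.
Qed.

(** * Scaled amplitude equation and leading-order expansion of the eigenvalues *)

Hypotheses (hE : critical_vectors S) (hk0 : k0 S < 0).
Hypotheses (hsc : scaling F) (hth : theta_spec S F) (hst : stripes S F)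
  (hlam : O_upto 1 (rlam F)).
Hypothesis Q_small : forall i j k, vanishing (fun e => Qf F e i j k).

Definition offset (e : R) : R := alp F e - Mqh S (kap F e) (bep F e) (th F e).

(** On the curve [Mqh], where [offset] is 0, this is the leading-order value of 3 k0 A'^2. *)
Definition amplitude_shift (e : R) : R :=
  3 / 4 * rho_be S * bep F e ^+ 2 + th F e * rho_ka S * kap F e ^+ 2.

Let bc (c : R) : bounded0 (fun=> c). Proof. exact: bounded0_cst. Qed.
Let b_al : bounded0 (alp F). Proof. by case: hsc => /O_upto0P. Qed.
Let b_be : bounded0 (bep F). Proof. by case: hsc => _ /O_upto0P. Qed.
Let b_ka : bounded0 (kap F). Proof. by case: hsc => _ _ /O_upto0P. Qed.
Let b_el : bounded0 (elp F). Proof. by case: hsc => _ _ _ /O_upto0P. Qed.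
Lemma bounded0_Ap : bounded0 (Ap F). Proof. by case: hsc => _ _ _ _ /O_upto0P. Qed.

Let b_th : bounded0 (th F).
Proof.
exists 1; apply: filterS hth => e [_ t0 t1 _].
by rewrite gtr0_norm.
Qed.

Lemma bounded0_offset : bounded0 offset.
Proof.
apply: bounded0B b_al _; apply: bounded0B.
  exact: bounded0M (bc _) (bounded0X _ b_be).
apply: bounded0M (bounded0X _ b_ka); apply: bounded0M (bc _).
exact: bounded0D b_th (bc _).
Qed.

Lemma bounded0_amplitude_shift : bounded0 amplitude_shift.
Proof.
apply: bounded0D; first exact: bounded0M (bc _) (bounded0X _ b_be).
by apply: bounded0M (bounded0X _ b_ka); apply: bounded0M (bc _).
Qed.

Lemma Ap_gt0 : \forall e \near 0^'+, 0 < Ap F e.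
Proof. by case: hst => H _ _ _; apply: filterS H => e []. Qed.

Lemma amplitude_eq : \forall e \near 0^'+,
  alp F e + rho_be S * bep F e ^+ 2 + rho_ka S * kap F e ^+ 2
  + rho_nl S (Qf F e) * Ap F e ^+ 2 + rA F e = 0.
Proof.
case: hst => H _ _ _; apply: filterS2 H (nbhs_right_gt 0) => e [_ _ _ _ /eqP] + e0.
by rewrite mulf_eq0 expf_eq0 /= gt_eqF //= => /eqP.
Qed.

(** Follows from (9 l + 15 k)(l - k) + 16 k^2 = (k + 3 l)^2: the left-hand side is the scaled omega
    plus rho_ka kappa'^2. *)
Lemma theta_eq : \forall e \near 0^'+,
  rho_ka S / 16 * (kap F e + 3 * elp F e) ^+ 2 =
  (1 - th F e) * rho_ka S * kap F e ^+ 2.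
Proof.
apply: filterS2 hth (nbhs_right_gt 0) => e [_ _ _ +] e0.
rewrite /omega /elf /kaf => H.
have e2 : e ^+ 2 != 0 by rewrite expf_neq0 ?gt_eqF.
apply: (mulfI e2).
have -> : e ^+ 2 * (rho_ka S / 16 * (kap F e + 3 * elp F e) ^+ 2) =
  (9 * (e * elp F e) + 15 * (e * kap F e)) * (e * elp F e - e * kap F e)
    * rho_ka S / 16 + rho_ka S * (e * kap F e) ^+ 2 by field.
by rewrite H; ring.
Qed.

Let v_rA : vanishing (rA F).
Proof. by case: hst => _ /O_upto1_vanishing. Qed.

Let v_rlam : vanishing (rlam F). Proof. exact: O_upto1_vanishing. Qed.

(** The difference [offset] - [amplitude_shift] is exactly alpha' + rho_be beta'^2 + rho_ka
    kappa'^2, and [rho_nl] is 3 k0 up to the vanishing 2 q0 + q2. *)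
Lemma vanishing_amplitude :
  vanishing (fun e => Ap F e ^+ 2 + (offset e - amplitude_shift e) / (3 * k0 S)).
Proof.
have k3 : 3 * k0 S != 0 by rewrite mulf_neq0 // lt_eqF.
have bA2 := bounded0X 2 bounded0_Ap.
have v0 := vanishing_q0 S Q_small; have v2 := vanishing_q2 S Q_small.
have := vanishingM (vanishingD (vanishingM (vanishingD
  (vanishingM v0 (bc 2)) v2) bA2) v_rA) (bc (3 * k0 S)^-1).
apply: vanishing_le; apply: filterS amplitude_eq => e H.
rewrite -normrN le_eqVlt; apply/orP; left; apply/eqP; congr `|_|.
apply: (mulIf k3); rewrite -mulrA mulVf // mulr1 mulNr mulrDl divfK //.
move: H; rewrite /offset /amplitude_shift /Mqh /rho_nl => H; lra.
Qed.

(** Twice the amplitude equation is subtracted from lambda' + A'^2 eta, which cancels 6 k0 A'^2. The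
    coefficients 1/4 - 2 and (1 - theta) - 2 are the -7/4 and -(theta + 1) of [Mqh]; what remains is
    small through the remainders and q0, q1, q2. *)
Lemma Re_lambda_expansion (s : bool) :
  vanishing (fun e => Re_lambda S F s e / e ^+ 2
    + (offset e - sgb R s * (2 * Ap F e * `|qf S F e / e|))).
Proof.
have bA2 := bounded0X 2 bounded0_Ap.
have v0 := vanishing_q0 S Q_small; have v1 := vanishing_q1 hE Q_small.
have v2 := vanishing_q2 S Q_small.
have vp := vanishing_pcoef hE Q_small b_be b_ka b_el.
have H1 := vanishingD (vanishingB v_rlam (vanishingM v_rA (bc 2)))
  (vanishingM (vanishingB (vanishingB (vanishingM v1 (bc 8))
    (vanishingM v0 (bc 2))) (vanishingM v2 (bc 2))) bA2).
have := vanishingD (vanishing_norm H1) (vanishingM vp bounded0_Ap).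
apply: vanishing_le; near=> e.
have e0 : 0 < e by near: e; exact: nbhs_right_gt.
have A0 : 0 < Ap F e by near: e; exact: Ap_gt0.
have amp : alp F e + rho_be S * bep F e ^+ 2 + rho_ka S * kap F e ^+ 2
  + rho_nl S (Qf F e) * Ap F e ^+ 2 + rA F e = 0 by near: e; exact: amplitude_eq.
have tht : rho_ka S / 16 * (kap F e + 3 * elp F e) ^+ 2 =
  (1 - th F e) * rho_ka S * kap F e ^+ 2 by near: e; exact: theta_eq.
rewrite (Re_lambdaE _ (ltW e0) (ltW A0)) mulrC mulKf ?expf_neq0 ?gt_eqF //.
set p := pcoef _ _ _ _ _; set x := qf S F e / e.
set N := normc _.
have -> : lambda_prime S (alp F e) (bep F e) (kap F e) (elp F e) (rlam F e) +
   Ap F e ^+ 2 * Defs.eta S (Qf F e) + sgb R s * (Ap F e * N) +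
   (offset e - sgb R s * (2 * Ap F e * `|x|)) =
   (rlam F e - rA F e * 2 + (q1 S (Qf F e) * 8 - q0 S (Qf F e) * 2
     - q2 S (Qf F e) * 2) * Ap F e ^+ 2)
   + sgb R s * ((N - `|2 * x|) * Ap F e).
  rewrite /lambda_prime /Defs.eta /offset /Mqh [`|2 * x|]normrM [`|2|]ger0_norm //.
  rewrite tht; move: amp; rewrite /rho_nl => amp.
  by lra.
apply: le_trans (ler_normD _ _) _.
rewrite normrM normr_sgb mul1r normrM (gtr0_norm A0).
have np : 0 <= normc p by case: (p) => ? ?; apply: sqrtr_ge0.
rewrite [leRHS]ger0_norm ?addr_ge0 ?mulr_ge0 ?(ltW A0) //.
by rewrite lerD2l ler_wpM2r ?(ltW A0) //; apply: normc_addR.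
Unshelve. all: by end_near. Qed.

Lemma vanishing_Re_lambda (s : bool) :
  eq_upto 2 (Re_lambda S F s) (fun=> 0) <->
  vanishing (fun e => offset e - sgb R s * (2 * Ap F e * `|qf S F e / e|)).
Proof.
have H := Re_lambda_expansion s.
apply: iff_trans (eq_uptoP (f' := fun e => Re_lambda S F s e / e ^+ 2)
  (g' := fun=> 0) _ _) _.
- apply: filterS (nbhs_right_gt 0) => e e0.
  by rewrite mulrC divfK // expf_neq0 // gt_eqF.
- by apply: nearW => e; rewrite mulr0.
split=> K.
  apply: vanishing_le (vanishingB H K); apply: nearW => e.
  by rewrite subr0 [in leRHS]addrAC subrr add0r.
apply: vanishing_le (vanishingB H K); apply: nearW => e.
by rewrite subr0 addrK.
Qed.

(** * The curves in scaled form and the two boundary criteria *)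

Lemma alf_near_curve (m : R -> R) (m' : R -> R) :
  (\forall e \near 0^'+, m e = e ^+ 2 * m' e) ->
  eq_upto 2 (alf F) m <-> vanishing (fun e => alp F e - m' e).
Proof. by apply: eq_uptoP; apply: nearW. Qed.

Lemma Mqh_fE (e : R) : Mqh_f S F e = e ^+ 2 * Mqh S (kap F e) (bep F e) (th F e).
Proof. by rewrite /Mqh_f /Mqh /kaf /bef; ring. Qed.

Let ddisc (e : R) :=
  4 * (qf S F e / e) ^+ 4 + 12 * k0 S * (qf S F e / e) ^+ 2 * amplitude_shift e.

(** Homogeneity of degree four in (q, beta, kappa): the sign of delta_M is therefore compared at
    order e^4, while its square root enters the curves at order e^2. *)
Lemma deltaM_fE (e : R) : e != 0 -> deltaM_f S F e = e ^+ 4 * ddisc e.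
Proof.
by move=> e0; rewrite /deltaM_f /deltaM /ddisc /amplitude_shift /kaf /bef; field.
Qed.

Lemma MqH_fE (s : bool) (e : R) : e != 0 -> MqH_f S F s e =
  e ^+ 2 * (Mqh S (kap F e) (bep F e) (th F e)
   - (3 * k0 S)^-1 * (2 * (qf S F e / e) ^+ 2 + sgb R s * Num.sqrt (ddisc e))).
Proof.
move=> e0; rewrite /MqH_f /MqH -/(Mqh_f S F e) Mqh_fE -/(deltaM_f S F e).
rewrite deltaM_fE // sqrtrM ?exprn_even_ge0 //.
have -> : Num.sqrt (e ^+ 4) = e ^+ 2 by rewrite (exprM e 2 2) sqrtr_sqr ger0_norm ?sqr_ge0.
have k3 : k0 S != 0 by rewrite lt_eqF.
set w := Num.sqrt _; set M := Mqh _ _ _ _.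
by field; rewrite e0.
Qed.

(** The splitting 2 A' |q/e| of the two eigenvalues is o(1), so both cross zero along the same
    curve. *)
Lemma boundary_o_case (s : bool) :
  vanishing (fun e => qf S F e / e) ->
  eq_upto 2 (Re_lambda S F s) (fun=> 0) <-> eq_upto 2 (alf F) (Mqh_f S F).
Proof.
move=> vq; apply: iff_trans (vanishing_Re_lambda s) _.
apply: iff_trans (iff_sym (alf_near_curve (nearW _ Mqh_fE))).
have b : bounded0 (fun e => sgb R s * (2 * Ap F e)).
  exact: bounded0M (bc _) (bounded0M (bc _) bounded0_Ap).
have K : vanishing (fun e => sgb R s * (2 * Ap F e * `|qf S F e / e|)).
  apply: vanishing_le (vanishingM (vanishing_norm vq) b).
  by apply: nearW => e; rewrite mulrA mulrC.
split=> H; [apply: vanishing_le (vanishingD H K)|apply: vanishing_le (vanishingB H K)].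
  by apply: nearW => e; rewrite subrK.
by apply: nearW => e.
Qed.

Lemma boundary_O_case (s : bool) :
  bounded0 (fun e => qf S F e / e) ->
  eq_upto 2 (Re_lambda S F s) (fun=> 0) <->
  [/\ exists t : R -> bool, eq_upto 2 (alf F) (fun e => MqH_f S F (t e) e),
      exists2 h, vanishing h & \forall e \near 0^'+, 0 <= sgb R s * offset e + h e
    & le_upto 4 (fun=> 0) (deltaM_f S F)].
Proof.
move=> bq; apply: iff_trans (vanishing_Re_lambda s) _.
have A0 : \forall e \near 0^'+, 0 <= Ap F e by apply: filterS Ap_gt0 => e /ltW.
apply: iff_trans (quadratic_boundary s hk0 bounded0_offset
  bounded0_amplitude_shift bounded0_Ap bq A0 vanishing_amplitude) _.
have en0 : \forall e \near (0 : R)^'+, e != 0.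
  by apply: filterS (nbhs_right_gt 0) => e /lt0r_neq0.
have curve (t : R -> bool) : eq_upto 2 (alf F) (fun e => MqH_f S F (t e) e) <->
    vanishing (fun e => offset e + (3 * k0 S)^-1 *
      (2 * (qf S F e / e) ^+ 2 + sgb R (t e) * Num.sqrt (ddisc e))).
  apply: iff_trans (alf_near_curve _) _.
    by apply: filterS en0 => e /MqH_fE ->.
  apply: vanishing_near; apply: nearW => e.
  by rewrite /offset opprB addrA addrAC.
have disc : le_upto 4 (fun=> 0) (deltaM_f S F) <->
    exists2 h, vanishing h & \forall e \near 0^'+, 0 <= ddisc e + h e.
  apply: le_uptoP; first by apply: nearW => e; rewrite mulr0.
  by apply: filterS en0 => e /deltaM_fE ->.
by split=> -[[t Ht] H1 H2]; split=> //; do ?[by exists t; apply/curve]; apply/disc.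
Qed.

Lemma le_upto_Mqh_alf :
  le_upto 2 (Mqh_f S F) (alf F) <->
  exists2 h, vanishing h & \forall e \near 0^'+, 0 <= sgb R true * offset e + h e.
Proof.
apply: iff_trans (le_uptoP (nearW _ Mqh_fE) (nearW _ (fun e => erefl))) _.
split=> -[h h0 H]; exists h => //; apply: filterS H => e; rewrite /offset /sgb; lra.
Qed.

Lemma le_upto_alf_Mqh :
  le_upto 2 (alf F) (Mqh_f S F) <->
  exists2 h, vanishing h & \forall e \near 0^'+, 0 <= sgb R false * offset e + h e.
Proof.
apply: iff_trans (le_uptoP (nearW _ (fun e => erefl)) (nearW _ Mqh_fE)) _.
split=> -[h h0 H]; exists h => //; apply: filterS H => e; rewrite /offset /sgb; lra.
Qed.

End Reduction.

(** * The prescribed scalings of Q and the conclusion *)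

Lemma bounded_tensor_small (R : realType) (g : R -> R) (Q Q' : R -> tensor2 R) :
  vanishing g -> bounded_tensor Q' ->
  (\forall e \near 0^'+, forall i j k, Q e i j k = g e * Q' e i j k) ->
  forall i j k, vanishing (fun e => Q e i j k).
Proof.
move=> g0 bQ QE i j k; apply: vanishing_le (vanishingM g0 (O_upto0P (bQ i j k))).
by apply: filterS QE => e ->.
Qed.

Lemma bounded0_qcoef (R : realType) (S : model R) (Q : R -> tensor2 R) :
  bounded_tensor Q -> bounded0 (fun e => qcoef S (Q e)).
Proof.
move=> bQ; have b i j k := O_upto0P (bQ i j k).
apply: bounded0_dot (bounded0_cV_cst _).
exact: bounded0_bil b (bounded0_cV_cst _) (bounded0_cV_cst _).
Qed.

Lemma qf_scale (R : realType) (S : model R) (F : qh_family R) (g : R -> R)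
    (Q' : R -> tensor2 R) :
  (\forall e \near 0^'+, forall i j k, Qf F e i j k = g e * Q' e i j k) ->
  \forall e \near 0^'+, qf S F e / e = g e / e * qcoef S (Q' e).
Proof.
apply: filterS => e QE; rewrite /qf mulrAC -qcoef_scale; congr (qcoef S _ / e).
by apply/funext => i; apply/funext => j; apply/funext => k.
Qed.

Theorem theorem3p17 (R : realType) (S : model R) (F : qh_family R)
  (hT : turing_instability S)
  (hM : lambda_M S != 0)
  (hE : critical_vectors S)
  (hK : symmetric3 (Kt S))
  (hk0 : k0 S < 0)
  (hsc : scaling F)
  (hth : theta_spec S F)
  (hst : stripes S F)
  (hlam : O_upto 1 (rlam F)) :
  (forall e : R, char_poly (L2qh S F e) =
     ('X - (lambda_qh S F true e)%:P) * ('X - (lambda_qh S F false e)%:P))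
  /\
  (forall (g : R -> R) (Q' : R -> tensor2 R),
     o_upto 1 g -> bounded_tensor Q' ->
     (\forall e \near 0^'+, forall i j k, Qf F e i j k = g e * Q' e i j k) ->
     forall s : bool,
       eq_upto 2 (Re_lambda S F s) (fun=> 0) <->
       eq_upto 2 (alf F) (Mqh_f S F))
  /\
  (forall Q' : R -> tensor2 R,
     bounded_tensor Q' ->
     (\forall e \near 0^'+, forall i j k, Qf F e i j k = e * Q' e i j k) ->
     (eq_upto 2 (Re_lambda S F true) (fun=> 0) <->
      [/\ exists s : R -> bool, eq_upto 2 (alf F) (fun e => MqH_f S F (s e) e),
          le_upto 2 (Mqh_f S F) (alf F)
        & le_upto 4 (fun=> 0) (deltaM_f S F)])
     /\
     (eq_upto 2 (Re_lambda S F false) (fun=> 0) <->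
      [/\ exists s : R -> bool, eq_upto 2 (alf F) (fun e => MqH_f S F (s e) e),
          le_upto 2 (alf F) (Mqh_f S F)
        & le_upto 4 (fun=> 0) (deltaM_f S F)])).
Proof.
split; first exact: char_poly_L2qh.
split=> [g Q' /o_uptoP g_o bQ' QE s|Q' bQ' QE].
  have ge0 : vanishing (fun e => g e / e) by [].
  (* Smallness of Q itself uses g = o(1); the stronger g = o(e) enters through q/e = (g/e) q'. *)
  have g0 : vanishing g.
    apply: vanishing_le (vanishingM ge0 (vanishing_bounded0 (@vanishing_id R))).
    by apply: filterS (nbhs_right_gt 0) => e e0; rewrite divfK ?gt_eqF.
  apply: (boundary_o_case hE hsc hth hst hlam (bounded_tensor_small g0 bQ' QE)).
  apply: (vanishing_near (qf_scale S QE)).2.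
  exact: vanishingM ge0 (bounded0_qcoef S bQ').
have QS := bounded_tensor_small (@vanishing_id R) bQ' QE.
have bq : bounded0 (fun e => qf S F e / e).
  apply: bounded0_le (bounded0_qcoef S bQ').
  apply: filterS2 (qf_scale S QE) (nbhs_right_gt 0) => e -> e0.
  by rewrite divff ?mul1r // gt_eqF.
(* The eigenvalue with sign s gives the condition s [offset] >= o(1), which is the side of [Mqh] on
   which its curve lies. *)
have B s := boundary_O_case hE hk0 hsc hth hst hlam QS s bq.
split; apply: iff_trans (B _) _; split=> -[H1 H2 H3]; split=> //.
- exact/le_upto_Mqh_alf.
- exact/le_upto_Mqh_alf.
- exact/le_upto_alf_Mqh.
- exact/le_upto_alf_Mqh.
Qed.
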